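(* Consider the linear regression model $X_k=\theta\phi_k+\varepsilon_k$, $k=1,\dots,n$, where $\theta\in\mathbb{R}$ is an unknown parameter, $(\phi_k)_{k=1,\dots,n}$ is a sequence of independent random variables, $(\varepsilon_k)_{k=1,\dots,n}$ is a sequence of martingale differences with respect to its natural filtration, and $(\phi_k)$ and $(\varepsilon_k)$ are independent. Let $\theta_n=\sum_{k=1}^n\phi_kX_k\big/\sum_{k=1}^n\phi_k^2$. Let $p\ge2$ and assume that for a constant $A$, $$\mathbf{E}\big[|\varepsilon_i|^p\,\big|\,\sigma\{\varepsilon_j,j\le i-1\}\big]\le A\quad\text{for all }i\in[1,n].$$ Then for all $x>0$, for each choice of sign $\pm$, $$\mathbf{P}\Big(\pm(\theta_n-\theta)\sqrt{\textstyle\sum_{k=1}^n\phi_k^2}\ge x\Big)\le\exp\Big\{-\frac{x^2}{2V^2}\Big\}+\frac{C_p}{x^p},$$ where $V^2=\frac14(p+2)^2e^pA^{2/p}$ and $C_p=(1+\frac2p)^pA$. In particular, for any $x>0$ there is $c_x>0$ not depending on $n$ such that $$\mathbf{P}\Big(\pm(\theta_n-\theta)\sqrt{\textstyle\sum_{k=1}^n\phi_k^2}\ge\sqrt n\,x\Big)=O\Big(\frac{c_x}{n^{p/2}}\Big),\quad n\to\infty.$$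
   Context: It is implicitly assumed that $\sum_{k=1}^n\phi_k^2>0$ almost surely, so that $\theta_n$ is well defined. *)

(* Defs.v *)
From HB Require Import structures.
From mathcomp Require Import all_boot all_order all_algebra.
From mathcomp Require Import all_classical all_reals all_analysis measurable_realfun.
Set Implicit Arguments. Unset Strict Implicit. Unset Printing Implicit Defensive.
Import Order.TTheory GRing.Theory Num.Theory.
Import numFieldNormedType.Exports.
Local Open Scope classical_set_scope.
Local Open Scope ring_scope.

Definition sigma_gen {T} {R : realType} (X : nat -> T -> R) (I : set nat)
  : set (set T) :=
  <<s [set A | exists k, I k /\ exists B : set R, measurable B /\ A = X k @^-1` B] >>.

Definition nat_filtr {T} {R : realType} (X : nat -> T -> R) (m : nat) :=
  sigma_gen X [set j | (1 <= j <= m)%N].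

Definition mutually_independent {d} {T : measurableType d} {R : realType}
  (P : probability T R) (X : nat -> T -> R) (I : set nat) :=
  forall (J : seq nat), uniq J -> (forall k, k \in J -> I k) ->
  forall B : nat -> set R, (forall k, measurable (B k)) ->
  P (\bigcap_(k in [set` J]) (X k @^-1` B k)) =
  (\prod_(k <- J) P (X k @^-1` B k))%E.

Definition indep_sigma {d} {T : measurableType d} {R : realType}
  (P : probability T R) (G H : set (set T)) :=
  forall A B, G A -> H B -> P (A `&` B) = (P A * P B)%E.

Definition cond_exp_version {d} {T : measurableType d} {R : realType}
  (P : probability T R) (G : set (set T)) (Y Z : T -> \bar R) :=
  (forall U : set (\bar R), measurable U -> G (Z @^-1` U)) /\
  (forall B, G B -> (\int[P]_(t in B) Z t = \int[P]_(t in B) Y t)%E).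

Definition Xobs {T} {R : realType} (theta : R) (phi eps : nat -> T -> R)
  (k : nat) (t : T) : R := theta * phi k t + eps k t.

Definition sumsq {T} {R : realType} (phi : nat -> T -> R) (n : nat) (t : T) : R :=
  \sum_(1 <= k < n.+1) phi k t ^+ 2.

Definition thetan {T} {R : realType} (theta : R) (phi eps : nat -> T -> R)
  (n : nat) (t : T) : R :=
  (\sum_(1 <= k < n.+1) phi k t * Xobs theta phi eps k t) / sumsq phi n t.

Definition regression_hyp {d} {T : measurableType d} {R : realType}
  (P : probability T R) (phi eps : nat -> T -> R) (p A : R) (n : nat) : Prop :=
  let I := [set k | (1 <= k <= n)%N] in
  (forall k, I k -> measurable_fun setT (phi k)) /\
  (forall k, I k -> measurable_fun setT (eps k)) /\
  mutually_independent P phi I /\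
  (forall i, I i -> P.-integrable setT (EFin \o eps i) /\
     cond_exp_version P (nat_filtr eps i.-1) (EFin \o eps i) (cst 0%E)) /\
  indep_sigma P (sigma_gen phi I) (sigma_gen eps I) /\
  (forall i, I i -> exists Z, cond_exp_version P (nat_filtr eps i.-1)
        (fun t => (`|eps i t| `^ p)%:E) Z /\ {ae P, forall t, (Z t <= A%:E)%E}) /\
  (* implicit standing assumption: sum phi_k^2 > 0 a.s. *)
  {ae P, forall t, 0 < sumsq phi n t}.

Definition Vsq {R : realType} (p A : R) : R :=
  (p + 2) ^+ 2 * expR p * A `^ (2 / p) / 4.

Definition Cp {R : realType} (p A : R) : R := (1 + 2 / p) `^ p * A.

(* Main.v *)
Require Import Defs.
From HB Require Import structures.
From mathcomp Require Import all_boot all_order all_algebra.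
From mathcomp Require Import ring lra.
From mathcomp Require Import all_classical all_reals all_analysis measurable_realfun.
Import Order.TTheory GRing.Theory Num.Theory.
Import numFieldNormedType.Exports.
Local Open Scope classical_set_scope.
Local Open Scope ring_scope.
Set Implicit Arguments. Unset Strict Implicit. Unset Printing Implicit Defensive.

(* On the event S = sum phi_k^2 > 0 the normalised error is
   sum_k w_k eps_k with w_k = phi_k / sqrt S, so sum_k w_k^2 = 1.  Since phi and
   eps are independent, Fubini reduces the claim to deterministic weights.

   For deterministic weights, with truncation level y and h >= 0,
     1{sum w_k eps_k >= x} <= sum_k |w_k eps_k|^p / y^p
                              + e^{-h x} prod_k e^{h w_k eps_k} 1{w_k eps_k <= y}.
   The first sum has mean at most A / y^p because sum |w_k|^p <= 1.  The product
   is integrated factor by factor by conditioning, using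
     e^{h u} <= 1 + h u + (e^p / 2) (h u)^2 + e^{h y} (|u| / y)^p   (u <= y),
   whose last term can be dropped if h y <= p.

   Put z = x^2 / (2 V^2), y0 = p x / (p + 2) and s = A / y0^p, so that the target
   is e^{-z} + s.  Parametrise h = p g / y0.  With y = y0 the jump term is s, and
   the exponential term is at most e^{-z} for g = z if z <= 1, for g = 1 if
   1 <= z <= p + 1, and for g = 2 if p + 1 <= z <= 2 (p + 1).  For larger z the
   value e^{-z} is too small to help: one takes y = y0 (1 + 1/p), which makes the
   jump term at most s / 2, and e^{h y} = y^p / A, which makes the exponential
   term at most the jump term. *)

(** * Elementary inequalities for exp, ln and real powers *)

Lemma expR_le_quad (R : realType) (p v : R) : 2 <= p -> v <= p ->
  expR v <= 1 + v + expR p / 2 * v ^+ 2.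
Proof.
move=> p2 vp.
have ep4 : 4 <= expR p.
  have := expR_ge1Dx (p / 2); have -> : expR p = expR (p / 2) ^+ 2.
    by rewrite -expRM_natl; congr expR; lra.
  nra.
have [v0|v0] := leP v 0.
  have h1 := expR_ge1Dx (- v); have e0 := expR_gt0 v.
  have h2 : expR v * expR (- v) = 1 by rewrite -expRD subrr expR0.
  have h3 : expR v <= 1 + v + v ^+ 2.
    have h4 : 0 <= - v * v ^+ 2 by rewrite mulr_ge0 ?sqr_ge0 ?oppr_ge0.
    rewrite -(@ler_pM2r _ (1 - v)); last lra.
    apply: (@le_trans _ _ 1); [rewrite -h2 ler_pM2l//; lra|lra].
  have := sqr_ge0 v; nra.
(* With E = e^q, the bound E - 1 <= q E is used twice: E^2 - 1 - 2q <= q (E - 1)(E + 2) <= q^2 E (E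
   + 2). Then E (E + 2) <= 2 e^p because E^2 <= e^p and e^p >= 4. *)
set q := v / 2.
have qE : v = 2 * q by rewrite /q; lra.
have evE : expR v = expR q ^+ 2 by rewrite -expRM_natl qE.
have hE : expR q ^+ 2 <= expR p by rewrite -evE ler_expR.
have e0 := expR_gt0 q; have q0 : 0 < q by lra.
have h2 : expR q * expR (- q) = 1 by rewrite -expRD subrr expR0.
have h3 : expR q - 1 <= q * expR q.
  have := expR_ge1Dx (- q); nra.
have h5 : 1 + q <= expR q := expR_ge1Dx q.
rewrite evE qE.
set E := expR q in e0 hE h2 h3 h5 *.
have k1 : E ^+ 2 - 1 - 2 * q <= q ^+ 2 * (E * (E + 2)).
  have : (E - 1) * (E + 1) <= q * E * (E + 1) by apply: ler_wpM2r; lra.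
  have : (E - 1) * (q * (E + 2)) <= q * E * (q * (E + 2)).
    by apply: ler_wpM2r => //; nra.
  nra.
have k2 : E * (E + 2) <= 2 * expR p by have [?|?] := leP 2 E; nra.
have : q ^+ 2 * (E * (E + 2)) <= q ^+ 2 * (2 * expR p).
  by apply: ler_wpM2l => //; exact: sqr_ge0.
lra.
Qed.

(** The map u |-> e^{hu} / u^p is nondecreasing where h u >= p; in logarithms this comes down to ln
    (y / u) <= y / u - 1. *)
Lemma expR_le_powR (R : realType) (p h u y : R) : 0 < h -> 0 < u -> u <= y ->
  p <= h * u -> 0 <= p ->
  expR (h * u) <= expR (h * y) / y `^ p * u `^ p.
Proof.
move=> h0 u0 uy phu p0.
have y0 : 0 < y by lra.
rewrite /powR !gt_eqF// -expRN -!expRD ler_expR.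
suff : p * (ln y - ln u) <= h * (y - u) by lra.
rewrite -ln_div ?posrE//.
have l1 : ln (y / u) <= y / u - 1.
  have -> : y / u = 1 + (y / u - 1) by ring.
  have yu : 1 <= y / u by rewrite ler_pdivlMr// mul1r.
  apply: (le_trans (le_ln1Dx _)); lra.
apply: (@le_trans _ _ (p * (y / u - 1))); first exact: ler_wpM2l.
have -> : y / u - 1 = (y - u) / u by field; rewrite gt_eqF.
rewrite mulrCA mulrC; apply: ler_wpM2r; first lra.
by rewrite ler_pdivrMr.
Qed.

Lemma expR1_le3 (R : realType) : expR 1 <= 3 :> R.
Proof.
(* Sixth power of e^{-1/6} >= 5/6; it suffices since (5/6)^6 > 1/3. *)
have h : (5 / 6) ^+ 6 <= expR (-1) :> R.
  have -> : (-1 : R) = 6%:R * (- (1 / 6)) by lra.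
  rewrite expRM_natl; apply: lerXn2r; rewrite ?nnegrE ?expR_ge0//.
  have := @expR_ge1Dx R (- (1 / 6)); lra.
have h2 : expR 1 * expR (- 1) = 1 :> R by rewrite -expRD subrr expR0.
have e0 := @expR_gt0 R 1; rewrite -(@ler_pM2r _ (expR (-1))) ?expR_gt0// h2.
by rewrite -ler_pdivrMl//; apply: le_trans h; lra.
Qed.

Lemma ln3_ge1 (R : realType) : 1 <= ln 3 :> R.
Proof. by rewrite -ler_expR lnK ?posrE ?expR1_le3. Qed.

(** The tangent of ln at 3 lies above ln, and ln 3 <= 4/3 because (4/3)^4 > 3. *)
Lemma ln_le_third (R : realType) (m : R) : 3 <= m -> ln m <= (m + 1) / 3.
Proof.
move=> m3.
have l3 : ln 3 <= 4 / 3 :> R.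
  rewrite -ler_expR lnK ?posrE//.
  have -> : 4 / 3 = 4%:R * (1 / 3) :> R by lra.
  rewrite expRM_natl.
  have : (4 / 3) ^+ 4 <= expR (1 / 3) ^+ 4 :> R.
    apply: lerXn2r; rewrite ?nnegrE ?expR_ge0//.
    have := @expR_ge1Dx R (1 / 3); lra.
  lra.
have -> : m = 3 * (1 + (m / 3 - 1)) by lra.
rewrite lnM ?posrE; [|lra|lra].
have := @le_ln1Dx R (m / 3 - 1); lra.
Qed.

(** Bernoulli's inequality for a real exponent: Young's inequality for the product of w and 1, with
    conjugate exponents r and r / (r - 1). *)
Lemma powR_bernoulli (R : realType) (w r : R) : 0 <= w -> 1 <= r ->
  1 + r * (w - 1) <= w `^ r.
Proof.
move=> w0; rewrite le_eqVlt => /predU1P[<-|r1]; first by rewrite powRr1//; lra.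
have r0 : 0 < r by lra.
have := @conjugate_powR R w 1 r (r / (r - 1)) w0 ler01 r0.
have rr : r - 1 != 0 by rewrite subr_eq0 gt_eqF.
have rn : r != 0 by rewrite gt_eqF.
have q0 : 0 < r / (r - 1) by rewrite divr_gt0//; lra.
have qE : r^-1 + (r / (r - 1))^-1 = 1 by field; rewrite rr rn.
rewrite powR1 mulr1 => /(_ q0 qE) h.
have : r * w <= r * (w `^ r / r + 1 / (r / (r - 1))) by apply: ler_wpM2l; [lra|].
have -> : r * (w `^ r / r + 1 / (r / (r - 1))) = w `^ r + (r - 1).
  by field; rewrite rr rn.
lra.
Qed.

(** * Majorants of the truncated exponential and choice of the parameters *)

(** Each term of the majorant has a controlled mean: the linear one vanishes by the martingale
    property, the last two are bounded through the p-th moment. *)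
Definition exp_dominated (R : realType) (p h y a c : R) : Prop :=
  forall u, u <= y -> expR (h * u) <= 1 + h * u + a * u ^+ 2 + c * `|u| `^ p.

Lemma exp_dominated_small (R : realType) (p h y : R) : 2 <= p -> 0 <= h ->
  h * y <= p -> exp_dominated p h y (expR p / 2 * h ^+ 2) 0.
Proof.
move=> p2 h0 hyp u uy.
have := @expR_le_quad R p (h * u) p2; rewrite exprMn mul0r addr0 mulrA; apply.
by apply: le_trans hyp; exact: ler_wpM2l.
Qed.

Lemma exp_dominated_large (R : realType) (p h y : R) : 2 <= p -> 0 < h ->
  exp_dominated p h y (expR p / 2 * h ^+ 2) (expR (h * y) / y `^ p).
Proof.
move=> p2 h0 u uy.
have c0 : 0 <= expR (h * y) / y `^ p by rewrite divr_ge0 ?expR_ge0 ?powR_ge0.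
have a0 : 0 <= expR p / 2 * h ^+ 2 * u ^+ 2.
  by rewrite mulr_ge0 ?sqr_ge0// mulr_ge0 ?sqr_ge0// divr_ge0 ?expR_ge0.
have [hu|hu] := leP (h * u) p.
  have := expR_le_quad p2 hu; rewrite exprMn mulrA.
  have := mulr_ge0 c0 (powR_ge0 `|u| p); lra.
have u0 : 0 < u by rewrite -(pmulr_rgt0 _ h0); lra.
rewrite (gtr0_norm u0).
have := @expR_le_powR R p h u y h0 u0 uy (ltW hu); lra.
Qed.

(** The final inequality compares the bound of [weighted_tail_dominated] with the target, so the
    whole optimisation takes place here, on real numbers. *)
Lemma fuk_parameters (R : realType) (p A x : R) : 2 <= p -> 0 < A -> 0 < x ->
  exists h y a c, [/\ [/\ 0 <= h, 0 < y, 0 <= a & 0 <= c], exp_dominated p h y a c &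
    A / y `^ p + expR (- (h * x) + a * A `^ (2 / p) + c * A) <=
    expR (- x ^+ 2 / (2 * Vsq p A)) + Cp p A / x `^ p].
Proof.
move=> p2 A0 x0.
have p0 : 0 < p by lra.
have pn0 : p != 0 by rewrite gt_eqF.
have p2n0 : p + 2 != 0 by rewrite gt_eqF//; lra.
have [y0 y0E] : exists y0, y0 = p * x / (p + 2) by eexists.
have y00 : 0 < y0 by rewrite y0E divr_gt0 ?mulr_gt0//; lra.
have e0 := expR_gt0 p.
have B0 : 0 < A `^ (2 / p) by rewrite powR_gt0.
have [z zE] : exists z, z = 2 * y0 ^+ 2 / (p ^+ 2 * expR p * A `^ (2 / p)).
  by eexists.
have z0 : 0 < z.
  rewrite zE; apply: divr_gt0; first by rewrite mulr_gt0// exprn_gt0.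
  by rewrite mulr_gt0// mulr_gt0// exprn_gt0.
have -> : - x ^+ 2 / (2 * Vsq p A) = - z.
  rewrite zE /Vsq y0E; field.
  by rewrite p2n0 pn0 (gt_eqF e0) (gt_eqF B0).
pose s := A / y0 `^ p.
have -> : Cp p A / x `^ p = s.
  have c0 : 0 < 1 + 2 / p by rewrite addr_gt0// divr_gt0.
  have <- : y0 `^ p * (1 + 2 / p) `^ p = x `^ p.
    rewrite -powRM ?ltW//; congr (_ `^ _).
    by rewrite y0E; field; rewrite pn0 p2n0.
  by rewrite /s /Cp; field; rewrite !gt_eqF ?powR_gt0.
have s0 : 0 < s by rewrite /s divr_gt0 ?powR_gt0.
(* Eliminates [A]: s = (2 / (p^2 e^p z))^(p/2). *)
have lns : ln s = p / 2 * (ln 2 - 2 * ln p - p - ln z).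
  rewrite /s zE !ln_div ?posrE ?mulr_gt0 ?powR_gt0 ?exprn_gt0//.
  rewrite !lnM ?posrE ?mulr_gt0 ?powR_gt0 ?exprn_gt0// ?lnXn// !ln_powR expRK.
  rewrite ?mulr2n; field; rewrite ?pn0//.
(* For h = p g / y0 the exponent to bound is - g (p + 2) + g^2 / z + c A. Since h y0 = p g, taking y
   = y0 allows c = 0 as long as g <= 1. *)
have aE g : expR p / 2 * (p * g / y0) ^+ 2 * A `^ (2 / p) = g ^+ 2 / z.
  by rewrite zE; field; rewrite !gt_eqF.
have hxE g : p * g / y0 * x = g * (p + 2).
  by rewrite y0E; field; rewrite p2n0 pn0 gt_eqF.
have hyE g : p * g / y0 * y0 = p * g by rewrite -mulrA mulVf ?mulr1 ?gt_eqF.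
have h_gt0 g : 0 < g -> 0 < p * g / y0.
  by move=> g0; rewrite divr_gt0// mulr_gt0.
have h_ge0 g : 0 <= g -> 0 <= p * g / y0.
  by move=> g0; rewrite divr_ge0 ?mulr_ge0// ltW.
have a_ge0 h : 0 <= expR p / 2 * h ^+ 2.
  by rewrite mulr_ge0 ?sqr_ge0// divr_ge0 ?expR_ge0.
have [z1|z1] := leP z 1.
  exists (p * z / y0), y0, (expR p / 2 * (p * z / y0) ^+ 2), 0; split; first split => //.
    by apply: h_ge0; lra.
  - by apply: exp_dominated_small; rewrite ?hyE ?h_ge0 ?(ltW z0)// ger_pMr.
  rewrite mul0r -/s addrC lerD2r ler_expR hxE aE addr0.
  have -> : z ^+ 2 / z = z by field; rewrite gt_eqF.
  nra.
have [zp|zp] := leP z (p + 1).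
  exists (p * 1 / y0), y0, (expR p / 2 * (p * 1 / y0) ^+ 2), 0; split; first split => //.
    by apply: h_ge0; lra.
  - by apply: exp_dominated_small; rewrite ?hyE ?h_ge0//; lra.
  rewrite mul0r -/s addrC lerD2r ler_expR hxE aE addr0 expr1n.
  have : 1 / z <= p + 2 - z; last lra.
  by rewrite ler_pdivrMr//; nra.
have [zm|zm] := leP z (2 * (p + 1)).
  exists (p * 2 / y0), y0, (expR p / 2 * (p * 2 / y0) ^+ 2),
    (expR (p * 2 / y0 * y0) / y0 `^ p); split; first split => //.
    - by apply: h_ge0; lra.
    - by rewrite divr_ge0 ?expR_ge0 ?powR_ge0.
  - by apply: exp_dominated_large => //; exact: h_gt0.
  rewrite -/s addrC lerD2r ler_expR hxE aE hyE.
  have -> : expR (p * 2) / y0 `^ p * A = expR (p * 2) * s by rewrite /s; ring.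
  (* Here 2p + ln s = 2 - (p - 2)^2 / 2 - p (ln p - ln 2) - (p/2)(ln 2 + ln z), which is at most 2 -
     ln 2 - ln z for p >= 2; and e^2 <= 9. *)
  have sE : expR (p * 2) * s <= 9 / (2 * z).
    rewrite -[s]lnK ?posrE// -expRD lns.
    apply: (@le_trans _ _ (expR (2 - ln 2 - ln z))).
      rewrite ler_expR.
      have lp : ln 2 <= ln p by rewrite ler_ln ?posrE.
      have l2 : 0 <= ln 2 + ln z by rewrite -lnM ?posrE// ln_ge0//; lra.
      have : 0 <= (p / 2 - 1) * (ln 2 + ln z) by rewrite mulr_ge0//; lra.
      have : 0 <= p * (ln p - ln 2) by rewrite mulr_ge0; lra.
      have := sqr_ge0 (p - 2); lra.
    have e2 : expR 2 <= 9 :> R.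
      have -> : expR 2 = expR 1 ^+ 2 :> R by rewrite -expRM_natl mulr1.
      have := expR1_le3 R; have := @expR_gt0 R 1; nra.
    rewrite (expRD (2 - ln 2)) (expRD 2) !expRN !lnK ?posrE// -mulrA -invfM.
    by apply: ler_wpM2r => //; rewrite invr_ge0 mulr_ge0// ltW.
  apply: (@le_trans _ _ (- (2 * (p + 2)) + 2 ^+ 2 / z + 9 / (2 * z))); first lra.
  have -> : - (2 * (p + 2)) + 2 ^+ 2 / z + 9 / (2 * z) =
    (17 / 2 - 2 * (p + 2) * z) / z by field; rewrite gt_eqF.
  by rewrite ler_pdivrMr//; nra.
pose m := p + 1.
have m0 : 0 < m by rewrite /m; lra.
have m3 : 3 <= m by rewrite /m; lra.
pose y := y0 * (m / p).
have mp0 : 0 < m / p by rewrite divr_gt0.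
have yp0 : 0 < y by rewrite mulr_gt0.
(* The solution of e^{hy} = y^p / A for h = p g / y0; it makes c A = 1 and, as h y = g m, also A /
   y^p = e^{-gm}. *)
pose g := p / (2 * m) * (p + ln z - ln 2 + 2 * ln m).
have hy : p * g / y0 * y = ln (y `^ p / A).
  have -> : p * g / y0 * y = g * m.
    by rewrite /y; field; rewrite pn0 gt_eqF.
  have -> : ln (y `^ p / A) = - ln s + p * ln (m / p).
    rewrite /s /y !ln_div ?posrE ?powR_gt0// !ln_powR lnM ?posrE// ln_div ?posrE//.
    ring.
  rewrite lns ln_div ?posrE// /g; field; rewrite gt_eqF//.
have lm1 : 1 <= ln m by rewrite (le_trans (ln3_ge1 R))// ler_ln ?posrE.
have lm2 := ln_le_third m3.
pose l := ln (z / (2 * m)).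
have l0 : 0 <= l.
  by rewrite ln_ge0// ler_pdivlMr ?mulr_gt0// mul1r ltW.
have lz : ln z = ln 2 + ln m + l.
  rewrite /l ln_div ?posrE ?mulr_gt0// lnM ?posrE//; ring.
have zl : 2 * m * (1 + l) <= z.
  have : 1 + l <= z / (2 * m).
    by rewrite -[leRHS]lnK ?posrE ?divr_gt0 ?mulr_gt0// expR_ge1Dx.
  by rewrite ler_pdivlMr ?mulr_gt0// mulrC.
have gE : g = (m - 1) / (2 * m) * (m - 1 + 3 * ln m + l).
  by rewrite /g lz /m; congr (_ / _ * _); ring.
have al : 0 < (m - 1) / (2 * m) by rewrite divr_gt0; lra.
have g0 : 0 < g by rewrite gE mulr_gt0//; lra.
(* The bound ln m <= (m + 1) / 3 makes m - 1 + 3 ln m + l at most 2m + l, hence at most z. *)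
have gz : g / z <= (m - 1) / (2 * m).
  rewrite ler_pdivrMr// gE ler_pM2l//; nra.
(* This is what - g (p + 2) + g^2 / z + 1 <= - g m amounts to. By ln m >= 1 and [gz], the product is
   at least (m - 1)(m + 2)(m + 1) / (4 m^2), which is at least 1 for m >= 3. *)
have g1 : 1 <= g * (1 - g / z).
  have a1 : 1 - (m - 1) / (2 * m) = (m + 1) / (2 * m) by field; rewrite gt_eqF.
  apply: (@le_trans _ _ (g * ((m + 1) / (2 * m)))); last first.
    by rewrite ler_pM2l//; lra.
  apply: (@le_trans _ _ ((m - 1) / (2 * m) * (m + 2) * ((m + 1) / (2 * m)))).
    have -> : (m - 1) / (2 * m) * (m + 2) * ((m + 1) / (2 * m)) =
      ((m - 1) * (m + 2) * (m + 1)) / (4 * m ^+ 2) by field; rewrite gt_eqF.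
    have : 0 <= (m - 3) * (m ^+ 2 + m + 2).
      by rewrite mulr_ge0 ?subr_ge0// !addr_ge0 ?sqr_ge0// ltW.
    rewrite ler_pdivlMr ?mulr_gt0 ?exprn_gt0// mul1r.
    lra.
  apply: ler_wpM2r; first by rewrite divr_ge0//; lra.
  rewrite gE; apply: ler_wpM2l; [exact: ltW|lra].
exists (p * g / y0), y, (expR p / 2 * (p * g / y0) ^+ 2),
    (expR (p * g / y0 * y) / y `^ p); split; first split => //.
  - by apply: h_ge0; lra.
  - by rewrite divr_ge0 ?expR_ge0 ?powR_ge0.
- by apply: exp_dominated_large => //; exact: h_gt0.
(* Bernoulli gives (1 + 1/p)^p >= 2. *)
have sy : A / y `^ p <= s / 2.
  have := @powR_bernoulli R (m / p) p (ltW mp0).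
  have -> : 1 + p * (m / p - 1) = 2 by rewrite /m; field.
  rewrite /y (powRM _ (ltW y00) (ltW mp0)) => h.
  rewrite /s -mulrA ler_pM2l// -invfM lef_pV2 ?posrE ?mulr_gt0 ?powR_gt0//.
  by rewrite ler_pM2l ?powR_gt0//; apply: h; lra.
suff : expR (- (p * g / y0 * x) + expR p / 2 * (p * g / y0) ^+ 2 * A `^ (2 / p) +
  expR (p * g / y0 * y) / y `^ p * A) <= A / y `^ p.
  have := expR_gt0 (- z); lra.
rewrite hxE aE.
have -> : expR (p * g / y0 * y) / y `^ p * A = 1.
  rewrite hy lnK ?posrE ?divr_gt0 ?powR_gt0//.
  by field; rewrite !gt_eqF ?powR_gt0.
have -> : A / y `^ p = expR (- (g * m)).
  have <- : p * g / y0 * y = g * m.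
    by rewrite /y; field; rewrite pn0 gt_eqF.
  by rewrite hy expRN lnK ?posrE ?divr_gt0 ?powR_gt0// invf_div.
rewrite ler_expR /m; move: g1.
have -> : g * (1 - g / z) = g - g ^+ 2 / z by field; rewrite gt_eqF.
lra.
Qed.

(** * Integration against weights measurable for a sub-sigma-algebra *)

Import HBNNSimple.

Section weights.
Context (d : measure_display) (T : measurableType d) (R : realType)
  (mu : {measure set T -> \bar R}) (G : set (set T)).
Hypothesis sG : forall B, <<s G >> B -> measurable B.

Lemma measurable_id_g_sigma :
  measurable_fun setT (id : T -> g_sigma_algebraType G).
Proof. by move=> _ B mB; rewrite setTI; exact: sG. Qed.

Lemma measurable_fun_g_sigma (d' : measure_display) (S : measurableType d')
    (W : g_sigma_algebraType G -> S) :
  measurable_fun setT W -> measurable_fun setT (W : T -> S).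
Proof. by move=> mW; exact: (measurableT_comp mW measurable_id_g_sigma). Qed.

Lemma ge0_integral_nnsfunM (h : {nnsfun g_sigma_algebraType G >-> R})
    (f : T -> \bar R) :
  (forall t, (0 <= f t)%E) -> measurable_fun setT f ->
  (\int[mu]_t ((h t)%:E * f t) =
   \sum_(y \in range h) y%:E * \int[mu]_(t in h @^-1` [set y]) f t)%E.
Proof.
move=> f0 mf.
have mh y : measurable (h @^-1` [set y] : set T).
  apply: sG; rewrite -[_ @^-1` _]setTI.
  exact: measurable_funP h measurableT _ (measurable_set1 y).
transitivity (\int[mu]_t (\sum_(y \in range h)
    (y * \1_(h @^-1` [set y]) t)%:E * f t))%E.
  apply: eq_integral => t _.
  rewrite -ge0_mule_fsuml => [|y]; last exact: nnfun_muleindic_ge0.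
  by rewrite fsumEFin // -(fimfunE h t).
have m1 y : measurable_fun [set: T] (fun t => (y * \1_(h @^-1` [set y]) t)%:E).
  apply/measurable_EFinP; apply: measurable_funM => //; exact: measurable_indic.
rewrite ge0_integral_fsum//; last 2 first.
- by move=> y; apply: emeasurable_funM.
- by move=> y t _; rewrite mule_ge0// nnfun_muleindic_ge0.
apply: eq_fsbigr => y; rewrite inE => -[t0 _ <-].
under eq_integral do rewrite EFinM -muleA.
rewrite ge0_integralZl//.
- under eq_integral do rewrite muleC.
  rewrite (eq_integral (f \_ (h @^-1` [set h t0] : set T))); last first.
    by move=> x xE; rewrite epatch_indic.
  by rewrite -integral_mkcond.
- by apply: emeasurable_funM => //; apply/measurable_EFinP; exact: measurable_indic.
- by move=> t _; rewrite mule_ge0// lee_fin.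
- by rewrite lee_fin.
Qed.

(** Replaces conditioning on the sub-sigma-algebra: a bound on its events passes to simple weights
    by linearity, then to [W] by monotone convergence. *)
Lemma le_integral_weight (f : T -> R) (K : R) (W : T -> R) :
  (forall t, 0 <= f t) -> measurable_fun setT f -> 0 <= K ->
  (forall B, <<s G >> B -> (\int[mu]_(t in B) (f t)%:E <= K%:E * mu B)%E) ->
  (forall t, 0 <= W t) ->
  measurable_fun setT (W : g_sigma_algebraType G -> R) ->
  (\int[mu]_t ((W t)%:E * (f t)%:E) <= K%:E * \int[mu]_t (W t)%:E)%E.
Proof.
move=> f0 mf' K0 fK W0 mW.
have mf : measurable_fun setT (EFin \o f) by exact/measurable_EFinP.
have mWT := measurable_fun_g_sigma mW.
have mWE : measurable_fun setT (EFin \o (W : g_sigma_algebraType G -> R)).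
  exact/measurable_EFinP.
(* The approximation is taken in the sub-sigma-algebra, so the level sets of [h n] are events to
   which [fK] applies. *)
pose h := nnsfun_approx measurableT mWE.
have hW t : (EFin \o h ^~ t) n @[n --> \oo] --> (W t)%:E.
  by apply: (cvg_nnsfun_approx measurableT mWE) => // x _; rewrite lee_fin.
have hnd t : nondecreasing_seq (fun n => (h n t)%:E).
  by move=> a b ab; rewrite lee_fin; exact/lefP/nd_nnsfun_approx.
have mh n : measurable_fun setT (h n : T -> R).
  by apply: measurable_fun_g_sigma; exact: measurable_funP.
have -> : (\int[mu]_t ((W t)%:E * (f t)%:E) =
    lim (\int[mu]_t ((h n t)%:E * (f t)%:E) @[n --> \oo]))%E.
  under eq_integral => t _.
    have -> : ((W t)%:E * (f t)%:E = lim ((h n t)%:E * (f t)%:E @[n --> \oo]))%E.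
      apply/esym/cvg_lim => //.
      by apply: cvgeZr; [|exact: hW].
    over.
  apply: monotone_convergence => //.
  - by move=> n; apply: emeasurable_funM => //; exact/measurable_EFinP.
  - by move=> n t _; rewrite mule_ge0// lee_fin.
  - by move=> t _ a b ab; apply: lee_wpmul2r; [rewrite lee_fin|exact: (hnd t _ _ ab)].
apply: lime_le.
  apply: ereal_nondecreasing_is_cvgn => a b ab.
  apply: ge0_le_integral => //.
  - by move=> t _; rewrite mule_ge0// lee_fin.
  - by apply: emeasurable_funM => //; exact/measurable_EFinP.
  - by apply: emeasurable_funM => //; exact/measurable_EFinP.
  - by move=> t _; apply: lee_wpmul2r; [rewrite lee_fin|exact: (hnd t _ _ ab)].
apply: nearW => n.
apply: (@le_trans _ _ (K%:E * \int[mu]_t (h n t)%:E)%E); last first.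
  rewrite lee_wpmul2l ?lee_fin//; apply: ge0_le_integral => //.
  - by move=> t _; rewrite lee_fin.
  - exact/measurable_EFinP.
  - exact/measurable_EFinP.
  - move=> t _; rewrite -(cvg_lim _ (hW t))//; apply: lime_ge.
      by apply/cvg_ex; exists (W t)%:E; exact: hW.
    by exists n => // k /= nk; exact: (hnd t _ _ nk).
have -> : (\int[mu]_t (h n t)%:E = \int[mu]_t ((h n t)%:E * cst 1 t))%E.
  by apply: eq_integral => t _; rewrite mule1.
rewrite !ge0_integral_nnsfunM// ge0_mule_fsumr; last first.
  move=> y; have [y0|y0] := leP 0 y; first by rewrite mule_ge0// integral_ge0.
  (* A negative y is not a value of the nonnegative [h n]. *)
  rewrite (_ : h n @^-1` [set y] = set0) ?integral_set0 ?mule0//.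
  by apply/seteqP; split => // t /= hy; move: y0; rewrite -hy ltNge; apply/negP/negPn.
apply: lee_fsum => // y [t _ <-].
have GB : <<s G >> (h n @^-1` [set h n t]).
  by have := measurable_funP (h n) measurableT _ (measurable_set1 (h n t)); rewrite setTI.
rewrite muleCA lee_wpmul2l ?lee_fin// integral_cst ?mul1e; last exact: sG.
exact: fK.
Qed.
End weights.

(** * Sigma-algebras generated by a sequence, and measurability *)

(** The generators of [sigma_gen], named so that [g_sigma_algebraType] applies to them;
    [sigma_gen X I] unfolds to [<<s gens X I>>]. *)
Definition gens (T : Type) (R : realType) (X : nat -> T -> R) (I : set nat) :
    set (set T) :=
  [set A | exists k, I k /\ exists B : set R, measurable B /\ A = X k @^-1` B].

Lemma sub_gens (d : measure_display) (T : measurableType d) (R : realType)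
    (X : nat -> T -> R) (I : set nat) :
  (forall k, I k -> measurable_fun setT (X k)) ->
  forall B, <<s gens X I >> B -> measurable B.
Proof.
move=> mX; apply: smallest_sub; first exact: sigma_algebra_measurable.
by move=> _ [k [Ik [B [mB ->]]]]; rewrite -[_ @^-1` _]setTI; exact: mX.
Qed.

Lemma measurable_gens (d : measure_display) (T : measurableType d) (R : realType)
    (X : nat -> T -> R) (I : set nat) (k : nat) : I k ->
  measurable_fun setT (X k : g_sigma_algebraType (gens X I) -> R).
Proof.
move=> Ik _ B mB; rewrite setTI; apply: sub_gen_smallest.
by exists k; split=> //; exists B.
Qed.

Lemma measurable_sum_nat1 (d : measure_display) (T : measurableType d)
    (R : realType) (f : nat -> T -> R) (n : nat) :
  (forall k, (1 <= k <= n)%N -> measurable_fun setT (f k)) ->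
  measurable_fun setT (fun t => \sum_(1 <= k < n.+1) f k t).
Proof.
move=> mf; under eq_fun do rewrite big_add1 big_mkord.
by apply: measurable_sum => i; apply: mf; rewrite ltn_ord.
Qed.

Lemma measurable_superlevel (d : measure_display) (T : measurableType d)
    (R : realType) (f : T -> R) (x : R) :
  measurable_fun setT f -> measurable [set t | x <= f t].
Proof.
move=> mf; rewrite (_ : [set t | _] = setT `&` f @^-1` `[x, +oo[%classic).
  exact: mf.
by rewrite setTI; apply/seteqP; split => t /=; rewrite in_itv/= andbT.
Qed.

(** * Tail bound for deterministic weights *)

Definition trunc_exp (R : realType) (h y u : R) : R := expR (h * u) * (u <= y)%R%:R.

Lemma trunc_exp_ge0 (R : realType) (h y u : R) : 0 <= trunc_exp h y u.
Proof. by rewrite mulr_ge0 ?expR_ge0. Qed.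

Lemma measurable_trunc_exp (R : realType) (h y : R) :
  measurable_fun setT (trunc_exp h y).
Proof.
apply: measurable_funM.
  by apply: measurableT_comp => //; exact: measurable_funM.
rewrite (_ : (fun u => _) = \1_`]-oo, y]); first exact: measurable_indic.
by apply/funext => u; rewrite indicE mem_setE in_itv.
Qed.

(* Pointwise substitute for the conditional Hoelder inequality: if |u|^p has
   conditional mean at most A, the right-hand side has mean at most A^(2/p). *)
Lemma sqr_le_powR (R : realType) (p A u : R) : 2 <= p -> 0 < A ->
  u ^+ 2 <= A `^ (2 / p) * (2 / p * (`|u| `^ p / A) + (1 - 2 / p)).
Proof.
move=> p2 A0; have p0 : 0 < p by lra.
have pn0 : p != 0 by rewrite gt_eqF.
have B0 : 0 < A `^ (2 / p) by rewrite powR_gt0.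
rewrite -ler_pdivrMl// [_^-1 * _]mulrC.
(* Bernoulli with exponent p/2 at w = u^2 / A^(2/p), for which w^(p/2) = |u|^p / A. *)
have := @powR_bernoulli R (u ^+ 2 / A `^ (2 / p)) (p / 2).
set w := u ^+ 2 / _ => h.
have w0 : 0 <= w by rewrite divr_ge0 ?sqr_ge0 ?powR_ge0.
have wE : w `^ (p / 2) = `|u| `^ p / A.
  rewrite /w powRM ?sqr_ge0 ?invr_ge0 ?powR_ge0//.
  congr (_ * _).
    rewrite -(real_normK (num_real u)) -powR_mulrn// -powRrM.
    by congr (_ `^ _); field.
  rewrite -powRN -powRrM (_ : - (2 / p) * (p / 2) = -1); last by field.
  by rewrite powR_inv1 ?ltW.
have h1 := h w0 (_ : 1 <= p / 2); rewrite wE in h1.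
have {}h1 : 1 + p / 2 * (w - 1) <= `|u| `^ p / A by apply: h1; lra.
have : 2 / p * (1 + p / 2 * (w - 1)) <= 2 / p * (`|u| `^ p / A).
  by rewrite ler_pM2l ?divr_gt0.
have -> : 2 / p * (1 + p / 2 * (w - 1)) = w - 1 + 2 / p by field.
lra.
Qed.

Section weighted_tail.
Context (d : measure_display) (T : measurableType d) (R : realType)
  (P : probability T R) (eps : nat -> T -> R) (p A : R) (n : nat).
Hypotheses (p2 : 2 <= p) (A0 : 0 < A).
Hypothesis meps : forall k, (1 <= k <= n)%N -> measurable_fun setT (eps k).
Hypothesis ieps : forall k, (1 <= k <= n)%N -> P.-integrable setT (EFin \o eps k).
Hypothesis eps_mean : forall k, (1 <= k <= n)%N ->
  forall B, nat_filtr eps k.-1 B -> (\int[P]_(t in B) (eps k t)%:E = 0)%E.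
Hypothesis eps_moment : forall k, (1 <= k <= n)%N ->
  forall B, nat_filtr eps k.-1 B ->
  (\int[P]_(t in B) (`|eps k t| `^ p)%:E <= A%:E * P B)%E.

Let p0 : 0 < p.
Proof. by apply: lt_le_trans p2. Qed.

Let filtr m := gens eps [set j | (1 <= j <= m)%N].

Let filtr_sub m : (m <= n)%N -> forall B, <<s filtr m >> B -> measurable B.
Proof.
move=> mn; apply: sub_gens => k /andP[k1 km]; apply: meps.
by rewrite k1 (leq_trans km).
Qed.

Let measurable_moment k : (1 <= k <= n)%N ->
  measurable_fun setT (fun t => `|eps k t| `^ p).
Proof.
move=> kn; apply: (@measurableT_comp _ _ _ _ _ _ (fun u : R => u `^ p)).
  exact: measurable_powR.
by apply: measurableT_comp => //; exact: meps.
Qed.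

Let moment_le k : (1 <= k <= n)%N -> (\int[P]_t (`|eps k t| `^ p)%:E <= A%:E)%E.
Proof.
move=> kn; have := @eps_moment k kn setT.
rewrite probability_setT mule1; apply.
by rewrite -setC0; apply: sigma_algebraC; exact: sigma_algebra0.
Qed.

Let integrable_moment k : (1 <= k <= n)%N ->
  P.-integrable setT (fun t => (`|eps k t| `^ p)%:E).
Proof.
move=> kn; apply/integrableP; split.
  by apply/measurable_EFinP; exact: measurable_moment.
under eq_integral do rewrite gee0_abs ?lee_fin ?powR_ge0//.
by rewrite (le_lt_trans (moment_le kn))// ltry.
Qed.

Variables (h y a c : R).
Hypotheses (h0 : 0 <= h) (y0 : 0 < y) (a0 : 0 <= a) (c0 : 0 <= c).
Hypothesis dom : exp_dominated p h y a c.
Variable w : nat -> R.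

Let f k t := trunc_exp h y (w k * eps k t).
(** Growth rate of the k-th factor. As sum w_k^2 = 1 and sum |w_k|^p <= 1, these add up to at most a
    A^(2/p) + c A. *)
Let gam k := a * A `^ (2 / p) * w k ^+ 2 + c * A * `|w k| `^ p.

Let f_le k t : f k t <=
  (1 + a * w k ^+ 2 * A `^ (2 / p) * (1 - 2 / p)) + h * w k * eps k t +
  (a * w k ^+ 2 * A `^ (2 / p) * (2 / p / A) + c * `|w k| `^ p) *
    (`|eps k t| `^ p).
Proof.
have A20 : 0 <= A `^ (2 / p) := powR_ge0 _ _.
have aw0 : 0 <= a * w k ^+ 2 by rewrite mulr_ge0 ?sqr_ge0.
have sq := ler_wpM2l aw0 (sqr_le_powR (eps k t) p2 A0).
set u := w k * eps k t.
apply: (@le_trans _ _ (1 + h * u + a * u ^+ 2 + c * `|u| `^ p)); last first.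
  by rewrite /u normrM powRM// exprMn; lra.
rewrite /f /trunc_exp -/u; have [uy|uy] := leP u y.
  by rewrite mulr1; exact: dom.
(* Beyond the truncation level the left side is 0, and u > y > 0 makes the right side
   nonnegative. *)
rewrite mulr0 !addr_ge0// mulr_ge0 ?sqr_ge0 ?powR_ge0//.
by rewrite (le_trans _ (ltW uy))// ltW.
Qed.

(** The majorant [f_le] is affine in eps_k and |eps_k|^p. Over an event of the past the first
    integrates to 0 and the second to at most A P(B), which gives (1 + gam k) P(B). *)
Let int_f_le k : (1 <= k <= n)%N -> forall B, nat_filtr eps k.-1 B ->
  (\int[P]_(t in B) (f k t)%:E <= (expR (gam k))%:E * P B)%E.
Proof.
move=> kn B FB.
have mB : measurable B.
  apply: filtr_sub FB; case/andP: kn => k1 kn; exact: leq_trans (leq_pred _) kn.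
set C := 1 + a * w k ^+ 2 * A `^ (2 / p) * (1 - 2 / p).
set D := a * w k ^+ 2 * A `^ (2 / p) * (2 / p / A) + c * `|w k| `^ p.
have D0 : 0 <= D.
  have q0 : 0 <= 2 / p / A by rewrite !divr_ge0// ltW.
  rewrite addr_ge0//; last by rewrite mulr_ge0 ?powR_ge0.
  by rewrite mulr_ge0// mulr_ge0 ?powR_ge0// mulr_ge0 ?sqr_ge0.
pose g t := (C%:E + ((h * w k)%:E * (eps k t)%:E + D%:E * (`|eps k t| `^ p)%:E))%E.
have i1 : P.-integrable B (cst C%:E).
  exact: finite_measure_integrable_cst.
have iS (u : T -> \bar R) : P.-integrable setT u -> P.-integrable B u.
  by move=> iu; exact: integrableS iu.
have i2 : P.-integrable B (fun t => (h * w k)%:E * (eps k t)%:E)%E.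
  by apply: integrableZl => //; apply: iS; exact: ieps.
have i3 : P.-integrable B (fun t => D%:E * (`|eps k t| `^ p)%:E)%E.
  by apply: integrableZl => //; apply: iS; exact: integrable_moment.
have i23 := integrableD mB i2 i3.
have ig : P.-integrable B g by exact: (integrableD mB i1 i23).
have mf : measurable_fun setT (f k).
  apply: (measurableT_comp (measurable_trunc_exp h y)).
  by apply: measurable_funM => //; exact: meps.
have fg t : ((f k t)%:E <= g t)%E.
  by rewrite /g -!EFinM -!EFinD lee_fin addrA; exact: f_le.
apply: (@le_trans _ _ (\int[P]_(t in B) g t)%E).
  apply: ge0_le_integral => //.
  - by move=> t _; rewrite lee_fin trunc_exp_ge0.
  - by apply/measurable_EFinP; exact: measurable_funTS.
  - exact: (measurable_int _ ig).
rewrite /g integralD// integralD// integralZl//; [|exact/iS/ieps].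
rewrite integralZl//; [|exact/iS/integrable_moment].
rewrite eps_mean// mule0 add0e integral_cst//.
apply: (@le_trans _ _ (C%:E * P B + D%:E * (A%:E * P B))%E).
  by rewrite leeD2l// lee_wpmul2l ?lee_fin// eps_moment.
rewrite muleA -EFinM -ge0_muleDl ?lee_fin; last 2 first.
- rewrite addr_ge0// mulr_ge0//; last by rewrite subr_ge0 ler_pdivrMr// mul1r.
  by rewrite mulr_ge0 ?powR_ge0// mulr_ge0 ?sqr_ge0.
- by rewrite mulr_ge0// ltW.
rewrite -EFinD lee_wpmul2r// lee_fin.
have -> : C + D * A = 1 + gam k.
  by rewrite /C /D /gam; field; rewrite (gt_eqF p0) (gt_eqF A0).
exact: expR_ge1Dx.
Qed.

Let W m t := \prod_(1 <= j < m.+1) f j t.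

Let W_ge0 m t : 0 <= W m t.
Proof. by apply: prodr_ge0 => j _; exact: trunc_exp_ge0. Qed.

Let measurable_W m :
  measurable_fun setT (W m : g_sigma_algebraType (filtr m) -> R).
Proof.
have mf j : (1 <= j <= m)%N ->
    measurable_fun setT (f j : g_sigma_algebraType (filtr m) -> R).
  move=> jm; apply: (measurableT_comp (measurable_trunc_exp h y)).
  by apply: measurable_funM => //; exact: measurable_gens.
(* The number of factors grows while the sigma-algebra stays that of time [m]. *)
suff H k : (k <= m)%N -> measurable_fun setT
    ((fun t => \prod_(1 <= j < k.+1) f j t) : g_sigma_algebraType (filtr m) -> R).
  exact: H.
elim: k => [_|k IH km].
  rewrite (_ : (fun t => _) = cst 1); first exact: measurable_cst.
  by apply/funext => t; rewrite big_geq.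
rewrite (_ : (fun t => _) = fun t => \prod_(1 <= j < k.+1) f j t * f k.+1 t).
  by apply: measurable_funM; [exact: IH (ltnW km)|exact: mf].
by apply/funext => t; rewrite big_nat_recr.
Qed.

(** Supermartingale argument: the last factor is peeled off with the product of the earlier ones as
    a weight measurable for the past. *)
Let int_W_le m : (m <= n)%N ->
  (\int[P]_t (W m t)%:E <= (expR (\sum_(1 <= j < m.+1) gam j))%:E)%E.
Proof.
elim: m => [_|m IH mn].
  under eq_integral do rewrite /W big_geq//.
  by rewrite integral_cst// mul1e big_geq// expR0; exact: probability_le1.
under eq_integral do rewrite /W big_nat_recr//= EFinM -/(W m _).
apply: (@le_trans _ _ ((expR (gam m.+1))%:E * \int[P]_t (W m t)%:E)%E).
  apply: (le_integral_weight (@filtr_sub m (ltnW mn))) => //.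
  - by move=> t; exact: trunc_exp_ge0.
  - apply: (measurableT_comp (measurable_trunc_exp h y)).
    by apply: measurable_funM => //; exact: meps.
  - by move=> B FB; apply: int_f_le.
  - by move=> t; exact: W_ge0.
rewrite big_nat_recr//= (expRD _ (gam m.+1)) EFinM muleC lee_wpmul2r ?lee_fin ?expR_ge0//.
exact: IH (ltnW mn).
Qed.

Lemma weighted_tail_dominated (x : R) : \sum_(1 <= k < n.+1) w k ^+ 2 = 1 ->
  (P [set t | (x <= \sum_(1 <= k < n.+1) w k * eps k t)%R] <=
   (A / y `^ p + expR (- (h * x) + a * A `^ (2 / p) + c * A))%:E)%E.
Proof.
move=> w1.
(* Each |w_k| is at most 1, so |w_k|^p <= w_k^2 as p >= 2. *)
have wp : \sum_(1 <= k < n.+1) `|w k| `^ p <= 1.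
  rewrite -w1 big_seq [leRHS]big_seq; apply: ler_sum => k kn.
  have wk1 : w k ^+ 2 <= 1.
    by rewrite -w1 (bigD1_seq k) ?iota_uniq//= lerDl sumr_ge0// => j _; exact: sqr_ge0.
  have [->|wk0] := eqVneq (w k) 0.
    by rewrite normr0 powR0 ?expr0n//= gt_eqF//; lra.
  rewrite -real_normK ?num_real// -powR_mulrn//.
  apply: ger_powR => //; rewrite normr_gt0 wk0/=.
  by rewrite -(@ler_pXn2r _ 2) ?nnegrE// expr1n real_normK ?num_real.
have mM : measurable_fun setT (fun t => \sum_(1 <= k < n.+1) w k * eps k t).
  apply: measurable_sum_nat1 => k kn; apply: measurable_funM => //.
  exact: meps.
set E := [set t | _].
have mE : measurable E by exact: measurable_superlevel.
pose v k := `|w k| `^ p / y `^ p.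
have v0 k : 0 <= v k by rewrite divr_ge0 ?powR_ge0.
have key t : \1_E t <= \sum_(i < n) v i.+1 * `|eps i.+1 t| `^ p +
   expR (- (h * x)) * W n t.
  have -> : \sum_(i < n) v i.+1 * `|eps i.+1 t| `^ p =
      \sum_(1 <= k < n.+1) v k * `|eps k t| `^ p by rewrite big_add1 big_mkord.
  have s0 k : 0 <= v k * `|eps k t| `^ p by rewrite mulr_ge0 ?powR_ge0.
  have e0 : 0 <= expR (- (h * x)) * W n t by rewrite mulr_ge0 ?expR_ge0.
  rewrite indicE; have [|_] := boolP (t \in E); last by rewrite addr_ge0 ?sumr_ge0.
  rewrite inE /E /= => xM.
  (* If no term exceeds y, the product is e^{h sum w_k eps_k} >= e^{hx}. Otherwise the single term
     with w_k eps_k > y already contributes at least 1 to the first sum. *)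
  have [/allP al|/allPn[k kn]] :=
    boolP (all (fun k => w k * eps k t <= y) (index_iota 1 n.+1)).
    rewrite ler_wpDl ?sumr_ge0// /W.
    rewrite (eq_big_seq (fun j => expR (h * (w j * eps j t)))); last first.
      by move=> j jn; rewrite /f /trunc_exp al// mulr1.
    rewrite -expR_sum -mulr_sumr -expRD -expR0 ler_expR addrC subr_ge0.
    exact: ler_wpM2l.
  rewrite -ltNge => yu; rewrite ler_wpDr//.
  rewrite (bigD1_seq k) ?iota_uniq//= ler_wpDr ?sumr_ge0//.
  rewrite /v mulrAC -powRM// -normrM ler_pdivlMr ?powR_gt0// mul1r.
  apply: ge0_ler_powR; rewrite ?nnegrE ?(ltW p0) ?(ltW y0)//.
  by rewrite (le_trans (ltW yu))// ler_norm.
have n1 (i : 'I_n) : (1 <= i.+1 <= n)%N by rewrite ltn_ord.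
have mW : measurable_fun setT (W n : T -> R).
  exact: (measurable_fun_g_sigma (@filtr_sub n (leqnn n)) (@measurable_W n)).
have mS (i : 'I_n) : measurable_fun setT (fun t => (v i.+1 * `|eps i.+1 t| `^ p)%:E).
  by apply/measurable_EFinP; apply: measurable_funM => //; exact: measurable_moment.
have -> : P E = (\int[P]_t (\1_E t)%:E)%E by rewrite integral_indic// setIT.
apply: (@le_trans _ _ (\int[P]_t (\sum_(i < n) (v i.+1 * `|eps i.+1 t| `^ p)%:E +
   (expR (- (h * x)))%:E * (W n t)%:E))%E).
  apply: ge0_le_integral => //.
  - by apply/measurable_EFinP; exact: measurable_indic.
  - apply: emeasurable_funD; first exact: emeasurable_sum.
    by apply: emeasurable_funM => //; exact/measurable_EFinP.
  - by move=> t _; rewrite sumEFin -EFinM -EFinD lee_fin.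
rewrite ge0_integralD//; first last.
- by apply: emeasurable_funM => //; exact/measurable_EFinP.
- by move=> t _; rewrite mule_ge0// lee_fin ?expR_ge0.
- exact: emeasurable_sum.
- by move=> t _; rewrite sume_ge0// => i _; rewrite lee_fin mulr_ge0 ?powR_ge0.
rewrite EFinD leeD//; last first.
  have -> : (\int[P]_t ((expR (- (h * x)))%:E * (W n t)%:E) =
      (expR (- (h * x)))%:E * \int[P]_t (W n t)%:E)%E.
    apply: ge0_integralZl => //; first exact/measurable_EFinP.
    by move=> t _; rewrite lee_fin W_ge0.
  rewrite -addrA expRD EFinM lee_wpmul2l ?lee_fin ?expR_ge0//.
  apply: (le_trans (int_W_le (leqnn n))); rewrite lee_fin ler_expR /gam.
  rewrite big_split/= -!mulr_sumr w1 mulr1 lerD2l -[leRHS]mulr1.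
  by apply: ler_wpM2l => //; rewrite mulr_ge0// ltW.
rewrite ge0_integral_sum//; last first.
  by move=> i t _; rewrite lee_fin mulr_ge0 ?powR_ge0.
apply: (@le_trans _ _ (\sum_(i < n) (v i.+1 * A)%:E)%E).
  apply: lee_sum => i _; under eq_integral do rewrite EFinM.
  rewrite ge0_integralZl//; first last.
  - by rewrite lee_fin.
  - by apply/measurable_EFinP; exact: measurable_moment.
  by rewrite (EFinM (v i.+1) A) lee_wpmul2l ?lee_fin// moment_le.
rewrite sumEFin lee_fin -mulr_suml /v -mulr_suml mulrAC.
rewrite -[leRHS]mul1r mulrA ler_wpM2r ?invr_ge0 ?powR_ge0//.
apply: ler_wpM2r; first exact: ltW.
by rewrite big_add1 big_mkord in wp.
Qed.

End weighted_tail.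

(** * Independence via Fubini, and bounds from conditional expectations *)

(** By independence the joint law agrees with the product of the marginals on rectangles, hence
    equals it; a bound on all sections then integrates against a probability. *)
Lemma fubini_prob_le (d d1 d2 : measure_display) (T : measurableType d)
    (T1 : measurableType d1) (T2 : measurableType d2) (R : realType)
    (P : probability T R) (X : {mfun T >-> T1}) (Y : {mfun T >-> T2})
    (E : set (T1 * T2)) (b : \bar R) :
  (forall A B, measurable A -> measurable B ->
    P (X @^-1` A `&` Y @^-1` B) = (P (X @^-1` A) * P (Y @^-1` B))%E) ->
  measurable E -> (forall t1, (P (Y @^-1` xsection E t1) <= b)%E) ->
  (P [set t | E (X t, Y t)] <= b)%E.
Proof.
move=> XY mE Eb.
have mXY : measurable_fun setT (fun t => (X t, Y t)).
  exact: measurable_fun_pair.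
have [Z ZE] : exists Z : {mfun T >-> (T1 * T2)%type},
    Z = (fun t => (X t, Y t)) :> (_ -> _).
  by exists (mfun_Sub (mem_set mXY)).
have -> : P [set t | E (X t, Y t)] = distribution P Z E.
  by rewrite /distribution /pushforward ZE.
rewrite -(@product_measure_unique _ _ _ _ _ (distribution P X) (distribution P Y))//.
  rewrite /product_measure1.
  apply: (@le_trans _ _ (\int[distribution P X]_x cst b x)%E).
    apply: ge0_le_integral => //.
      exact: measurable_fun_xsection.
    by move=> t1 _; exact: Eb.
  rewrite integral_cst// [X in (b * X)%E](_ : _ = 1%E) ?mule1//.
  exact: probability_setT.
move=> A B mA mB; rewrite -[RHS]XY//.
by change (P (Z @^-1` (A `*` B)) = P (X @^-1` A `&` Y @^-1` B)); rewrite ZE.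
Qed.

(** [Z] may take either sign, so positive and negative parts are compared separately, the latter
    with reversed inequality. *)
Lemma ae_le_integral_cst (d : measure_display) (T : measurableType d)
    (R : realType) (mu : {measure set T -> \bar R}) (B : set T)
    (Z : T -> \bar R) (a : \bar R) : measurable B -> measurable_fun B Z ->
  {ae mu, forall t, (Z t <= a)%E} -> (\int[mu]_(t in B) Z t <= a * mu B)%E.
Proof.
move=> mB mZ Za; rewrite -integral_cst// integralE [leRHS]integralE.
apply: leeB; apply: ae_ge0_le_integral => //.
- exact: measurable_funepos.
- exact: measurable_funepos.
- apply: filterS Za => t Zt _.
  by rewrite !funeposE ge_max !le_max Zt lexx !orbT.
- exact: measurable_funeneg.
- exact: measurable_funeneg.
- apply: filterS Za => t Zt _.
  by rewrite !funenegE ge_max !le_max leeN2 Zt lexx !orbT.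
Qed.

Lemma cond_exp_version_le (d : measure_display) (T : measurableType d)
    (R : realType) (P : probability T R) (G : set (set T)) (Y Z : T -> \bar R)
    (A : \bar R) (B : set T) :
  (forall B, G B -> measurable B) -> G B -> cond_exp_version P G Y Z ->
  {ae P, forall t, (Z t <= A)%E} -> (\int[P]_(t in B) Y t <= A * P B)%E.
Proof.
move=> sG GB [mZ ZY] ZA; rewrite -ZY//; apply: ae_le_integral_cst => //.
  exact: sG.
apply: measurable_funTS => _ U mU; rewrite setTI.
by apply: sG; exact: mZ.
Qed.

(** * From deterministic weights to the regression error *)

Section regression.
Context (R : realType) (d : measure_display) (T : measurableType d)
  (P : probability T R) (phi eps : nat -> T -> R) (theta p A : R) (n : nat).
Hypothesis p2 : 2 <= p.
Hypothesis reg : regression_hyp P phi eps p A n.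

(** For n = 0 the sum of squares is empty, so it cannot be positive almost surely. *)
Lemma regression_n_gt0 : (0 < n)%N.
Proof.
have [_ [_ [_ [_ [_ [_ S0]]]]]] := reg.
case: n S0 => // S0; exfalso.
have : P setT = 0%E.
  apply: (@measure_negligible _ _ _ P) => //.
  by apply: negligibleS S0 => t _ /=; rewrite /sumsq big_geq// ltxx.
by rewrite probability_setT => /eqP; rewrite onee_eq0.
Qed.

Lemma regression_filtr_sub k : (1 <= k <= n)%N ->
  forall B, nat_filtr eps k.-1 B -> measurable B.
Proof.
case: reg => _ [meps _] /andP[k1 kn].
apply: sub_gens => j /andP[j1 jk]; apply: meps => /=.
by rewrite j1 (leq_trans jk)// (leq_trans (leq_pred k)).
Qed.

Lemma regression_moment k : (1 <= k <= n)%N -> forall B, nat_filtr eps k.-1 B ->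
  (\int[P]_(t in B) (`|eps k t| `^ p)%:E <= A%:E * P B)%E.
Proof.
move=> kn B FB; have [_ [_ [_ [_ [_ [mom _]]]]]] := reg.
have [Z [ZE ZA]] := mom k kn.
exact: (cond_exp_version_le (regression_filtr_sub kn) FB ZE ZA).
Qed.

Lemma regression_A_ge0 : 0 <= A.
Proof.
have n1 : (1 <= 1 <= n)%N by rewrite regression_n_gt0.
have := @regression_moment 1%N n1 setT.
rewrite probability_setT mule1 => /(_ _)/le_trans => h.
rewrite -lee_fin; apply: le_trans (h _ _ (lexx _)).
  by apply: integral_ge0 => t _; rewrite lee_fin powR_ge0.
by rewrite -setC0; apply: sigma_algebraC; exact: sigma_algebra0.
Qed.

Lemma weighted_tail (w : nat -> R) (x : R) : 0 < x ->
  \sum_(1 <= k < n.+1) w k ^+ 2 = 1 ->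
  (P [set t | (x <= \sum_(1 <= k < n.+1) w k * eps k t)%R] <=
   (expR (- x ^+ 2 / (2 * Vsq p A)) + Cp p A / x `^ p)%:E)%E.
Proof.
move=> x0 w1; have [_ [meps [_ [mart _]]]] := reg.
(* [fuk_parameters] needs A > 0. For A = 0 the variance term is 0, division by 0 yields 0, and the
   bound is e^0 = 1. *)
have := regression_A_ge0; rewrite le_eqVlt => /predU1P[<-|A0].
  have p0 : 0 < p by apply: lt_le_trans p2.
  rewrite /Vsq /Cp powR0; last by rewrite mulf_neq0// invr_eq0 gt_eqF.
  rewrite !(mulr0, mul0r, invr0) expR0 addr0; apply: probability_le1.
  have mM : measurable_fun setT (fun t => \sum_(1 <= k < n.+1) w k * eps k t).
    by apply: measurable_sum_nat1 => k kn; apply: measurable_funM => //; exact: meps.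
  exact: measurable_superlevel.
have [h [y [a [c [[h0 y0 a0 c0] dom hb]]]]] := fuk_parameters p2 A0 x0.
apply: le_trans (_ : (_%:E <= _)%E); last by rewrite lee_fin; exact: hb.
apply: (weighted_tail_dominated p2 A0 meps _ _ regression_moment) => //.
- by move=> k kn; have [] := mart k kn.
- move=> k kn B FB; have [_ [_ ME]] := mart k kn.
  by rewrite -(ME B FB) integral0.
Qed.

(** The factor [sg] treats both signs at once: sg^2 = 1 keeps the squares of the weights summing to
    1. *)
Lemma regression_tail (sg x : R) : sg ^+ 2 = 1 -> 0 < x ->
  (P [set t | (x <= sg * (thetan theta phi eps n t - theta) *
                     Num.sqrt (sumsq phi n t))%R] <=
   (expR (- x ^+ 2 / (2 * Vsq p A)) + Cp p A / x `^ p)%:E)%E.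
Proof.
move=> sg1 x0; have [mphi [meps [_ [_ [ind _]]]]] := reg.
set b := (_ + _)%R.
have b0 : 0 <= b.
  rewrite addr_ge0 ?expR_ge0// divr_ge0 ?powR_ge0// mulr_ge0 ?powR_ge0//.
  exact: regression_A_ge0.
(* T1 and T2 are T with the sigma-algebras of phi and of eps; independence says
   that t |-> (t, t) : T -> T1 * T2 has a product law. *)
pose I := [set k | (1 <= k <= n)%N].
pose T1 := g_sigma_algebraType (gens phi I).
pose T2 := g_sigma_algebraType (gens eps I).
have m1 : measurable_fun setT (id : T -> T1).
  exact: measurable_id_g_sigma (sub_gens mphi).
have m2 : measurable_fun setT (id : T -> T2).
  exact: measurable_id_g_sigma (sub_gens meps).
have [X XE] : exists X : {mfun T >-> T1}, X = id :> (T -> T).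
  by exists (mfun_Sub (mem_set m1)).
have [Y YE] : exists Y : {mfun T >-> T2}, Y = id :> (T -> T).
  by exists (mfun_Sub (mem_set m2)).
have S0 t : 0 <= sumsq phi n t by apply: sumr_ge0 => k _; exact: sqr_ge0.
pose M (z : T1 * T2) := \sum_(1 <= k < n.+1) sg * phi k z.1 * eps k z.2.
(* Including S > 0 in E makes its sections empty where the weights are undefined. *)
pose E : set (T1 * T2) := [set z | 0 < sumsq phi n z.1 /\
  x * Num.sqrt (sumsq phi n z.1) <= M z].
have mS : measurable_fun setT (fun z : T1 * T2 => sumsq phi n z.1).
  apply: (@measurableT_comp _ _ _ _ _ _ (sumsq phi n : T1 -> R)) => //.
  apply: measurable_sum_nat1 => k kn; apply: measurable_funX.
  exact: measurable_gens.
have mM : measurable_fun setT M.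
  apply: measurable_sum_nat1 => k kn; apply: measurable_funM.
    apply: measurable_funM => //.
    apply: (@measurableT_comp _ _ _ _ _ _ (phi k : T1 -> R)) => //.
    exact: measurable_gens.
  apply: (@measurableT_comp _ _ _ _ _ _ (eps k : T2 -> R)) => //.
  exact: measurable_gens.
have msq : measurable_fun setT (fun z : T1 * T2 => Num.sqrt (sumsq phi n z.1)).
  apply: measurableT_comp mS; apply: continuous_measurable_fun.
  exact: sqrt_continuous.
have mE : measurable E.
  rewrite (_ : E = [set z | 0 < sumsq phi n z.1] `&`
      [set z | 0 <= M z - x * Num.sqrt (sumsq phi n z.1)]).
    apply: measurableI.
      rewrite (_ : [set z | _] = ~` [set z | 0 <= - sumsq phi n z.1]).
        apply: measurableC; apply: measurable_superlevel.
        exact: measurable_funN.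
      by apply/seteqP; split => z /=; rewrite oppr_ge0 ltNge => /negP.
    apply: measurable_superlevel; apply: measurable_funB => //.
    exact: measurable_funM.
  by apply/seteqP; split => z; rewrite /E /= subr_ge0.
have thE t : 0 < sumsq phi n t -> sg * (thetan theta phi eps n t - theta) *
    Num.sqrt (sumsq phi n t) = M (t, t) / Num.sqrt (sumsq phi n t).
  move=> St; have sq0 : 0 < Num.sqrt (sumsq phi n t) by rewrite sqrtr_gt0.
  have -> : M (t, t) = sg * \sum_(1 <= k < n.+1) phi k t * eps k t.
    by rewrite /M mulr_sumr; apply: eq_bigr => k _; rewrite mulrA.
  have -> : thetan theta phi eps n t =
      theta + (\sum_(1 <= k < n.+1) phi k t * eps k t) / sumsq phi n t.
    rewrite /thetan (eq_bigr (fun k => theta * phi k t ^+ 2 + phi k t * eps k t)).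
      by rewrite big_split/= -mulr_sumr mulrDl mulfK// gt_eqF.
    by move=> k _; rewrite /Xobs; ring.
  rewrite addrAC subrr add0r -{1}(sqr_sqrtr (S0 t)).
  by field; rewrite gt_eqF.
have eventE : [set t | x <= sg * (thetan theta phi eps n t - theta) *
    Num.sqrt (sumsq phi n t)] = [set t | E (X t, Y t)].
  rewrite XE YE; apply/seteqP; split => t; rewrite /E /=.
    (* Where S = 0 the square root vanishes while x > 0, so the two events agree everywhere and not
       only almost surely. *)
    have := S0 t; rewrite le_eqVlt => /predU1P[<-|St].
      by rewrite sqrtr0 mulr0 => /(lt_le_trans x0); rewrite ltxx.
    by rewrite thE// ler_pdivlMr ?sqrtr_gt0.
  by move=> [St]; rewrite thE// ler_pdivlMr ?sqrtr_gt0.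
rewrite eventE; apply: fubini_prob_le => //.
  by move=> B C mB mC; rewrite XE YE; exact: ind.
move=> t; rewrite YE.
have [St|St] := leP (sumsq phi n t) 0.
  rewrite (_ : _ @^-1` _ = set0) ?measure0 ?lee_fin//.
  by apply/seteqP; split => // u /=; rewrite /xsection/= inE /E/= ltNge St => -[].
pose w k := sg * phi k t / Num.sqrt (sumsq phi n t).
have sq0 : 0 < Num.sqrt (sumsq phi n t) by rewrite sqrtr_gt0.
rewrite (_ : _ @^-1` _ = [set u | x <= \sum_(1 <= k < n.+1) w k * eps k u]).
  apply: weighted_tail => //.
  under eq_bigr do rewrite /w expr_div_n exprMn sg1 mul1r sqr_sqrtr//.
  by rewrite -mulr_suml divff// gt_eqF.
have wE u : \sum_(1 <= k < n.+1) w k * eps k u = M (t, u) / Num.sqrt (sumsq phi n t).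
  by rewrite /M mulr_suml; apply: eq_bigr => k _; rewrite /w mulrAC.
apply/seteqP; split => u /=; rewrite /xsection/= inE /E/= wE ler_pdivlMr//.
  by case.
Qed.

End regression.

(** * The polynomial rate in n and conclusion *)

Lemma regression_hyp_le (R : realType) (d : measure_display)
    (T : measurableType d) (P : probability T R) (phi eps : nat -> T -> R)
    (p A B : R) (n : nat) : A <= B ->
  regression_hyp P phi eps p A n -> regression_hyp P phi eps p B n.
Proof.
move=> AB [h1 [h2 [h3 [h4 [h5 [h6 h7]]]]]].
split=> //; split=> //; split=> //; split=> //; split=> //; split=> //.
move=> i Ii; have [Z [ZE ZA]] := h6 i Ii; exists Z; split=> //.
by apply: filterS ZA => t /le_trans; apply; rewrite lee_fin.
Qed.

(** With r = n x^2 / (p V^2) the exponential term is (e^{-r})^(p/2), and e^{-r} <= 1 / r; the other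
    term scales exactly as n^(-p/2). *)
Lemma tail_rate (R : realType) (p A x : R) (n : nat) :
  2 <= p -> 0 < A -> 0 < x -> (0 < n)%N ->
  expR (- (Num.sqrt n%:R * x) ^+ 2 / (2 * Vsq p A)) +
    Cp p A / (Num.sqrt n%:R * x) `^ p <=
  ((p * Vsq p A / x ^+ 2) `^ (p / 2) + Cp p A / x `^ p) / n%:R `^ (p / 2).
Proof.
move=> p2 A0 x0 n0; have nR : 0 < n%:R :> R by rewrite ltr0n.
have p0 : 0 < p by lra.
have V0 : 0 < Vsq p A.
  by rewrite /Vsq !mulr_gt0 ?expR_gt0 ?powR_gt0 ?exprn_gt0 ?invr_gt0//; lra.
have sn : Num.sqrt n%:R = n%:R `^ 2^-1 :> R by rewrite powR12_sqrt// ltW.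
rewrite [leRHS]mulrDl; apply: lerD; last first.
  rewrite powRM ?sqrtr_ge0 ?(ltW x0)// sn -powRrM [2^-1 * p]mulrC.
  by rewrite [(_ * x `^ p)^-1]invfM mulrA mulrAC.
rewrite exprMn sqr_sqrtr ?(ltW nR)//.
pose r := n%:R * x ^+ 2 / (p * Vsq p A).
have r0 : 0 < r by rewrite !divr_gt0// mulr_gt0// exprn_gt0.
have -> : - (n%:R * x ^+ 2) / (2 * Vsq p A) = - r * (p / 2).
  by rewrite /r; field; rewrite !gt_eqF.
rewrite expRM.
have -> : (p * Vsq p A / x ^+ 2) `^ (p / 2) / n%:R `^ (p / 2) = r^-1 `^ (p / 2).
  have -> : p * Vsq p A / x ^+ 2 = r^-1 * n%:R.
    by rewrite /r; field; rewrite !gt_eqF.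
  by rewrite powRM ?invr_ge0 ?(ltW r0) ?(ltW nR)// mulfK// gt_eqF ?powR_gt0.
apply: ge0_ler_powR; rewrite ?nnegrE ?expR_ge0 ?invr_ge0 ?(ltW r0)//; first lra.
rewrite expRN lef_pV2 ?posrE ?expR_gt0//.
have := expR_ge1Dx r; lra.
Qed.

Theorem theorem3p3 (R : realType) (d : measure_display) (T : measurableType d)
  (P : probability T R) (phi eps : nat -> T -> R) (theta p A : R) :
  2 <= p ->
  (forall n, regression_hyp P phi eps p A n ->
    forall x : R, 0 < x ->
      (P [set t | (x <= (thetan theta phi eps n t - theta) * Num.sqrt (sumsq phi n t))%R]
         <= (expR (- x ^+ 2 / (2 * Vsq p A)) + Cp p A / x `^ p)%:E)%E /\
      (P [set t | (x <= - (thetan theta phi eps n t - theta) * Num.sqrt (sumsq phi n t))%R]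
         <= (expR (- x ^+ 2 / (2 * Vsq p A)) + Cp p A / x `^ p)%:E)%E) /\
  ((forall n, (1 <= n)%N -> regression_hyp P phi eps p A n) ->
    forall x : R, 0 < x -> exists c, 0 < c /\ exists N, forall n, (N <= n)%N ->
      (P [set t | (Num.sqrt n%:R * x <=
                  (thetan theta phi eps n t - theta) * Num.sqrt (sumsq phi n t))%R]
         <= (c / n%:R `^ (p / 2))%:E)%E /\
      (P [set t | (Num.sqrt n%:R * x <=
                  - (thetan theta phi eps n t - theta) * Num.sqrt (sumsq phi n t))%R]
         <= (c / n%:R `^ (p / 2))%:E)%E).
Proof.
move=> p2.
have main B n : regression_hyp P phi eps p B n -> forall x : R, 0 < x ->
    (P [set t | (x <= (thetan theta phi eps n t - theta) * Num.sqrt (sumsq phi n t))%R]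
       <= (expR (- x ^+ 2 / (2 * Vsq p B)) + Cp p B / x `^ p)%:E)%E /\
    (P [set t | (x <= - (thetan theta phi eps n t - theta) * Num.sqrt (sumsq phi n t))%R]
       <= (expR (- x ^+ 2 / (2 * Vsq p B)) + Cp p B / x `^ p)%:E)%E.
  move=> reg x x0.
  have h1 := regression_tail theta p2 reg (expr1n _ 2) x0.
  have h2 := regression_tail theta p2 reg (sqrr_sign _ 1) x0.
  split; [move: h1|move: h2]; apply: le_trans; rewrite le_eqVlt; apply/orP; left.
    by apply/eqP; congr (P _); apply/funext => t /=; rewrite mul1r.
  by apply/eqP; congr (P _); apply/funext => t /=; rewrite expr1 mulN1r.
split; first by move=> n; exact: main.
move=> reg x x0.
(* If A = 0 then Vsq = 0 and, since x / 0 = 0, the exponential term is 1. *)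
pose B := Num.max A 1.
have B0 : 0 < B by rewrite lt_max ltr01 orbT.
exists ((p * Vsq p B / x ^+ 2) `^ (p / 2) + Cp p B / x `^ p); split.
  rewrite ltr_wpDl ?powR_ge0// divr_gt0 ?powR_gt0// mulr_gt0 ?powR_gt0//.
  by rewrite addr_gt0// divr_gt0//; lra.
(* The estimate holds for every n >= 1, with a constant free of n. *)
exists 1%N => n n1.
have regB : regression_hyp P phi eps p B n.
  by apply: regression_hyp_le (reg n n1); rewrite le_max lexx.
have snx : 0 < Num.sqrt n%:R * x by rewrite mulr_gt0// sqrtr_gt0 ltr0n.
have rate := tail_rate p2 B0 x0 n1.
have [h1 h2] := main B n regB _ snx.
by split; [apply: (le_trans h1)|apply: (le_trans h2)]; rewrite lee_fin.
Qed.
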